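(* Let $H$ be an oriented graph on $t$ vertices and let $r = \mathrm{FAS}(H)\geq 1$. Then there is a constant $c(H)>0$, depending only on $H$, such that for all positive integers $n$ and $b$ with $b > c(H)\cdot n^{t/r}$, in the $b$-biased orientation game on the edges of $K_n$ Breaker has a strategy guaranteeing that the obtained tournament does not contain a copy of $H$.
   Context: An oriented graph is a finite directed graph with no loops, no parallel edges and no pair of opposite edges. For an oriented graph $H$ and a bijection $\sigma: V(H)\to\{1,\dots,|V(H)|\}$ let $\mathrm{FAS}(H,\sigma)=|\{(u,v)\in E(H):\sigma(u)>\sigma(v)\}|$, where $(u,v)$ denotes the edge directed from $u$ to $v$, and let $\mathrm{FAS}(H)=\min_\sigma \mathrm{FAS}(H,\sigma)$. A copy of $H$ in a tournament is a (not necessarily induced) directed subgraph isomorphic to $H$. The $b$-biased (i.e. $(1:b)$) orientation game on $K_n$: two players, Maker and Breaker, take turns in orienting previously undirected edges of the complete graph $K_n$. Maker starts. In each round Maker orients exactly one previously undirected edge, and then Breaker orients at least one and at most $b$ previously undirected edges (if any remain). The game ends when all edges are oriented, so that a tournament is obtained. A copy of $H$ counts no matter which player oriented each of its edges. *)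

(* Defs.v *)
From mathcomp Require Import all_boot.

Set Implicit Arguments.
Unset Strict Implicit.
Unset Printing Implicit Defensive.

(* A digraph on a finite vertex type is its edge relation: [e u v] says that
   (u, v) is an edge. *)
Definition oriented_graph (V : finType) (e : rel V) : Prop :=
  irreflexive e /\ forall u v : V, e u v -> ~~ e v u.

(* Vertices are numbered by 'I_#|V|, that is, from 0 instead of 1; an injective
   map between these two types of equal cardinality is a bijection. *)
Definition FAS_order (V : finType) (e : rel V) (s : {ffun V -> 'I_#|V|}) : nat :=
  #|[set p : V * V | e p.1 p.2 && (s p.2 < s p.1)]|.

(* [finfun enum_rank] is only the witness, required by [arg min], that some
   numbering exists. *)
Definition FAS (V : finType) (e : rel V) : nat :=
  FAS_order e
    [arg min_(s < [ffun v => enum_rank v] | injectiveb s) FAS_order e s].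

Section OrientationGame.

Variable n : nat.

Definition arc : predArgType := ('I_n * 'I_n)%type.

Implicit Types (P D : {set arc}) (a : arc) (h : seq {set arc}).

(* A position P is the set of all arcs chosen so far; [undirected P a] says
   that the edge of K_n underlying [a] has not been oriented yet. *)
Definition undirected P a : bool :=
  [&& a.1 != a.2, a \notin P & (a.2, a.1) \notin P].

Definition all_oriented P : Prop := forall a, ~~ undirected P a.

Definition breaker_move (b : nat) P D : Prop :=
  [/\ forall a, a \in D -> undirected P a,
      forall a, a \in D -> (a.2, a.1) \notin D
    & 0 < #|D| <= b].

(* A history is the list of the moves made so far, in chronological order: the
   moves at even indices are Maker's, those at odd indices are Breaker's. *)
Definition position h : {set arc} := \bigcup_(D <- h) D.

Definition strategy : Type := seq {set arc} -> {set arc}.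

(* The histories that can occur when Breaker follows S. Legality of Breaker's
   moves is not built in here; it is demanded in [breaker_strategy]. *)
Inductive follows (S : strategy) : seq {set arc} -> Prop :=
| follows_start : follows S [::]
| follows_maker h a :
    follows S h -> ~~ odd (size h) -> undirected (position h) a ->
    follows S (rcons h [set a])
| follows_breaker h :
    follows S h -> odd (size h) -> ~ all_oriented (position h) ->
    follows S (rcons h (S h)).

Definition breaker_strategy (b : nat) (S : strategy) : Prop :=
  forall h, follows S h -> odd (size h) -> ~ all_oriented (position h) ->
  breaker_move b (position h) (S h).

Definition contains_copy (V : finType) (e : rel V) P : Prop :=
  exists f : V -> 'I_n, injective f /\ forall u v, e u v -> (f u, f v) \in P.

(* All plays end, since every legal move orients at least one edge. *)
Definition breaker_can_avoid (b : nat) (V : finType) (e : rel V) : Prop :=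
  exists2 S : strategy, breaker_strategy b S &
    forall h, follows S h -> all_oriented (position h) ->
    ~ contains_copy e (position h).

End OrientationGame.

(* Main.v *)
Require Import Defs.
From mathcomp Require Import all_boot all_order all_algebra.
From mathcomp Require Import reals exp.

(** Breaker fixes a linear order of the vertices and only ever orients edges
    forward, so every backward arc of the final tournament is Maker's.  In any
    linear order a copy of H has at least r = FAS(H) backward arcs
    ([leq_card_backward_arcs]).  Breaker therefore wins as soon as he wins the
    Maker-Breaker game whose winning sets are the sets of backward arcs of the
    at most n^t potential copies, where Breaker claims an arc by orienting its
    edge the other way.

    That game is handled by Beck's biased version of the Erdos-Selfridge
    argument.  A winning set not yet touched by Breaker weighs (1 + b)^k, where
    k counts the elements that Maker has claimed in it.  When Maker claims x,
    the total weight grows by b times the weight of the sets through x; by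
    claiming b times in a row the currently heaviest element, Breaker has saved
    at least as much just before ([potential_reply]).  So the weight seen by
    Breaker never exceeds its initial value, which is at most n^t, whereas a
    completed copy would weigh at least (1 + b)^r > n^t.

    This bookkeeping needs Breaker to be the first player: an additional move
    of Maker at the start could cost a factor 1 + b and spoil the exponent t/r.
    But Breaker may choose the linear order after Maker's first move, and he
    chooses it such that Maker's first arc is forward, hence harmless.  The
    result is that n^t < (1 + b)^r suffices ([breaker_can_avoid_pow]), and the
    theorem holds with c(H) = 1. *)

Set Implicit Arguments.
Unset Strict Implicit.
Unset Printing Implicit Defensive.

(** * The potential of a biased Maker-Breaker game *)

Section Potential.

Variables (T I : finType) (W : I -> {set T}) (b : nat).
Implicit Types (M B D F : {set T}) (x : T).

(** The usual weights (1 + b)^(- number of unclaimed elements) would need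
    rational numbers; counting the claimed elements instead keeps the potential
    a natural number and suits winning sets of different sizes. *)
Definition potential M B : nat :=
  \sum_(i | [disjoint W i & B]) b.+1 ^ #|W i :&: M|.

Definition danger M B x : nat :=
  \sum_(i | [disjoint W i & B] && (x \in W i)) b.+1 ^ #|W i :&: M|.

Lemma potential_le M B M' B' :
  (forall i x, x \in W i -> x \in M -> x \in M') ->
  (forall i x, x \in W i -> x \in B' -> x \in B) ->
  potential M B <= potential M' B'.
Proof.
move=> sM sB; rewrite /potential [leqRHS](bigID (fun i => [disjoint W i & B])) /=.
apply: leq_trans (leq_addr _ _).
rewrite [leqRHS](eq_bigl (fun i => [disjoint W i & B])); last first.
  move=> i; case dB: [disjoint W i & B]; last by rewrite andbF.
  rewrite andbT; apply/pred0P => x /=; apply/negP => /andP[xW xB'].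
  by have := disjointFr dB xW; rewrite (sB _ _ xW xB').
apply: leq_sum => i _; rewrite leq_pexp2l // subset_leq_card //.
apply/subsetP => x; rewrite !inE => /andP[xW xM].
by rewrite xW (sM _ _ xW xM).
Qed.

Lemma potential_set0_le B : potential set0 B <= #|I|.
Proof.
rewrite -sum1_card /potential big_mkcond /=.
by apply: leq_sum => i _; rewrite setI0 cards0 expn0; case: ifP.
Qed.

Lemma expn_card_le_potential M B i :
  [disjoint W i & B] -> W i \subset M -> b.+1 ^ #|W i| <= potential M B.
Proof.
by move=> dB /setIidPl sM; rewrite /potential (bigD1 i) //= sM leq_addr.
Qed.

Lemma potential_breaker M B x :
  potential M (x |: B) + danger M B x = potential M B.
Proof.
rewrite /potential [RHS](bigID (fun i => x \in W i)) /= addnC; congr (_ + _).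
apply: eq_bigl => i; rewrite disjoint_sym.
have /eq_disjoint -> : x |: B =i predU1 x [in B] by move=> y; rewrite !inE.
by rewrite disjointU1 disjoint_sym andbC.
Qed.

Lemma potential_maker M B x :
  potential (x |: M) B <= potential M B + b * danger M B x.
Proof.
rewrite /danger big_distrr big_mkcondr /= -big_split /=.
apply: leq_sum => i _; case: ifPn => xW.
  rewrite -mulSn -expnS leq_pexp2l // setIUr.
  apply: leq_trans (leq_card_setU _ _) _; rewrite -add1n leq_add2r.
  by rewrite -(cards1 x) subset_leq_card // subsetIr.
rewrite addn0 leq_pexp2l // subset_leq_card //; apply/subsetP => y.
rewrite !inE => /andP[yW /predU1P[yx|->]]; rewrite ?yW //.
by rewrite -yx yW in xW.
Qed.

Lemma danger_anti M B B' x :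
  B \subset B' -> danger M B' x <= danger M B x.
Proof.
move=> sB; rewrite /danger [leqRHS](bigID (fun i => [disjoint W i & B'])) /=.
apply: leq_trans (leq_addr _ _); apply: eq_leq; apply: eq_bigl => i.
case dB: [disjoint W i & B']; last by rewrite andbF.
by rewrite (disjointWr sB dB) andbT.
Qed.

(** The new element is the most dangerous one left, so what Breaker gains in a
    step is at least the danger of any x that stays free, both now and later:
    dangers only decrease when Breaker claims more. *)
Lemma greedy_reply M B F k : exists D : {set T},
  [/\ D \subset F, #|D| <= k & D = F \/
      #|D| = k /\ forall x, x \in F :\: D ->
        potential M (D :|: B) + k * danger M (D :|: B) x <= potential M B].
Proof.
elim: k => [|k [D [sDF leD [eDF|[cD hD]]]]].
- exists set0; rewrite sub0set cards0; split=> //; right; split=> // x _.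
  by rewrite set0U mul0n addn0.
- by exists D; split=> //; [apply: leqW | left].
have [/eqP|[y0 y0F]] := set_0Vmem (F :\: D).
  rewrite setD_eq0 => sFD; exists D; split; [by []|exact: leqW|left].
  by apply/eqP; rewrite eqEsubset sDF.
pose dg := danger M (D :|: B).
case: (arg_maxnP dg y0F) => y yF ymax.
have /setDP[yFF yD] := yF.
exists (y |: D); split.
- by rewrite subUset sub1set yFF.
- by rewrite cardsU1 yD cD.
right; split=> [|x]; first by rewrite cardsU1 yD cD.
rewrite !inE negb_or -andbA => /and3P[_ xD xF].
have xFD : x \in F :\: D by rewrite inE xD.
rewrite -setUA; apply: leq_trans (hD x xFD).
rewrite -(potential_breaker M (D :|: B) y) -addnA leq_add2l mulSn.
have le_dg : danger M (y |: (D :|: B)) x <= dg x.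
  by apply: danger_anti; rewrite subsetUr.
apply: leq_add; last by rewrite leq_mul2l le_dg orbT.
exact: leq_trans le_dg (ymax x xFD).
Qed.

(** Breaker moves before Maker in this round, so he can prepay for the growth
    that Maker's next claim will cause. *)
Lemma potential_reply M B F : 0 < b -> F != set0 -> exists D : {set T},
  [/\ D \subset F, 0 < #|D| <= b & forall x, x \in F :\: D ->
      potential (x |: M) (D :|: B) <= potential M B].
Proof.
move=> b_gt0 F0; have [D [sDF leD hD]] := greedy_reply M B F b.
exists D; split=> // [|x xFD].
  by rewrite leD andbT; case: hD => [->|[-> _]]; rewrite ?card_gt0.
case: hD => [eDF|[_ hD]]; first by rewrite eDF setDv inE in xFD.
exact: leq_trans (potential_maker _ _ _) (hD x xFD).
Qed.

End Potential.

(** * The minimum number of backward arcs *)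

(** Any injective numbering can be compressed to one by ranks, which is the kind
    that [FAS] minimises over. *)
Lemma FAS_le (V : finType) (e : rel V) (g : V -> nat) : injective g ->
  FAS e <= #|[set p : V * V | e p.1 p.2 && (g p.2 < g p.1)]|.
Proof.
move=> g_inj; rewrite /FAS.
case: arg_minnP => [|s _ smin].
  by apply/injectiveP => u v; rewrite !ffunE => /enum_rank_inj.
have lt_rank v : #|[set u | g u < g v]| < #|V|.
  rewrite -cardsT proper_card // properT.
  by apply/eqP => /setP/(_ v); rewrite !inE ltnn.
pose rk := [ffun v => Ordinal (lt_rank v)].
have rk_lt u v : (rk u < rk v) = (g u < g v).
  have mono x y : g x < g y -> rk x < rk y.
    move=> lt_xy; rewrite !ffunE /= proper_card //; apply/properP; split.
      by apply/subsetP => w; rewrite !inE => /ltn_trans->.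
    by exists x; rewrite !inE ?ltnn.
  case: (ltngtP (g u) (g v)) => [/mono //|/mono lt_vu|/g_inj ->].
    by apply/negbTE; rewrite -leqNgt ltnW.
  by rewrite ltnn.
have rk_inj : injectiveb rk.
  apply/injectiveP => u v eq_uv; apply: g_inj.
  by have := rk_lt u v; have := rk_lt v u; rewrite eq_uv ltnn; case: ltngtP.
apply: leq_trans (smin rk rk_inj) _.
by apply: eq_leq; apply: eq_card => p; rewrite !inE rk_lt.
Qed.

(** * Breaker's strategy *)

Section Breaker.

Variables (n b : nat) (V : finType) (e : rel V).
Implicit Types (P D : {set Defs.arc n}) (a : Defs.arc n).
Implicit Types (h : seq {set Defs.arc n}).

Definition flip a : Defs.arc n := (a.2, a.1).

Lemma flipK : involutive flip. Proof. by case. Qed.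

Lemma mem_flip a P : (a \in flip @: P) = (flip a \in P).
Proof.
by rewrite -{1}[a]flipK (mem_imset _ _ (inv_inj flipK)).
Qed.

Lemma undirected_flip P a : undirected P (flip a) = undirected P a.
Proof.
case: a => x y.
by rewrite /undirected /= eq_sym [in RHS](andbC (_ \notin P)).
Qed.

Lemma undirectedU P D a :
  undirected (P :|: D) a = [&& undirected P a, a \notin D & flip a \notin D].
Proof.
rewrite /undirected !inE !negb_or /flip.
by do ?case: (_ \notin _); rewrite ?andbF ?andbT.
Qed.

(** The vertex order that Breaker adopts: the natural one or its reverse,
    whichever makes the first arc of the play forward. *)
Definition rank h (i : 'I_n) : nat :=
  if [exists a in head set0 h, a.1 < a.2] then val i else n - i.

Lemma rank_inj h : injective (rank h).
Proof.
rewrite /rank => i j; case: ifP => _ /eqP; first by move/eqP/val_inj.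
by rewrite eqn_sub2lE ?(ltnW (ltn_ord _)) // => /eqP/val_inj.
Qed.

Definition backward h a := rank h a.2 < rank h a.1.

Lemma backward_flip h a : a.1 != a.2 -> backward h (flip a) = ~~ backward h a.
Proof.
rewrite /backward /= -leqNgt [RHS]leq_eqVlt -(inj_eq (@rank_inj h)).
by move=> /negbTE->.
Qed.

Lemma backward_irr h a : backward h a -> a.1 != a.2.
Proof. by rewrite /backward; apply: contraTneq => ->; rewrite ltnn. Qed.

Lemma first_arc_forward a : a.1 != a.2 -> ~~ backward [:: [set a]] a.
Proof.
move=> aN; rewrite /backward /rank /=.
case: ifPn => [/exists_inP[_ /set1P-> lt_a]|/exists_inPn/(_ a (set11 a))].
  by rewrite -leqNgt ltnW.
by rewrite -!leqNgt => le_a; rewrite leq_sub2l.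
Qed.

Definition backward_arcs h (f : {ffun V -> 'I_n}) : {set Defs.arc n} :=
  [set (f p.1, f p.2) |
     p in [set p : V * V | e p.1 p.2 & backward h (f p.1, f p.2)]].

Lemma backward_arcsP h f a : a \in backward_arcs h f -> backward h a.
Proof. by case/imsetP => p; rewrite inE => /andP[_ ?] ->. Qed.

Lemma leq_card_backward_arcs h (f : {ffun V -> 'I_n}) : injective f ->
  FAS e <= #|backward_arcs h f|.
Proof.
move=> f_inj; rewrite card_imset.
  exact: FAS_le (inj_comp (@rank_inj h) f_inj).
by move=> [u v] [u' v'] /= [/f_inj-> /f_inj->].
Qed.

(** Orienting an edge claims one of its two arcs as such and, for the player
    who wants to keep arcs out of the tournament, the opposite one.  Winning
    sets contain backward arcs only, so the forward arcs in either claim have no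
    effect and the players need not be told apart. *)
Definition weight h P := potential (backward_arcs h) b P (flip @: P).

(** A forward move of Maker is harmless: it lies in no winning set, and it rules
    out the backward arc on the same edge, just as a move of Breaker would. *)
Lemma weight_forward h P a : ~~ backward h a -> weight h (a |: P) <= weight h P.
Proof.
move=> fa; apply: potential_le => f x /backward_arcsP xb.
  by rewrite in_setU1 => /predU1P[xa|//]; rewrite xa (negbTE fa) in xb.
by rewrite !mem_flip in_setU1 => ->; rewrite orbT.
Qed.

Lemma weight_rcons h D P : h != [::] -> weight (rcons h D) P = weight h P.
Proof. by case: h. Qed.

Lemma weight_set0 h : weight h set0 <= n ^ #|V|.
Proof.
by apply: leq_trans (potential_set0_le _ _ _) _; rewrite card_ffun card_ord.
Qed.

Definition free_backward h P := [set a | undirected P a && backward h a].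

(** Breaker thinks of a reply as the set D of backward arcs that it rules out;
    on the board he plays [flip @: D]. *)
Definition good_reply h P D :=
  [&& D \subset free_backward h P, 0 < #|D| <= b &
    [forall x in free_backward h P :\: D,
       potential (backward_arcs h) b (x |: P) (D :|: flip @: P)
         <= weight h P]].

Definition breaker_reply : strategy n := fun h =>
  flip @: odflt set0 [pick D | good_reply h (position h) D].

Lemma breaker_replyP h : 0 < b -> ~ all_oriented (position h) ->
  exists2 D, good_reply h (position h) D & breaker_reply h = flip @: D.
Proof.
move=> b_gt0 nall; rewrite /breaker_reply.
case: pickP => [D gD|noD]; first by exists D.
have F0 : free_backward h (position h) != set0.
  apply: contra_notN nall => /eqP/setP F0 a; apply/negP => ua.
  have aN : a.1 != a.2 by case/and3P: ua.
  have := F0 a; have := F0 (flip a).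
  by rewrite !inE undirected_flip ua (backward_flip h aN) /=; case: (backward h a).
have [D [sD cD hD]] := potential_reply (backward_arcs h)
  (position h) (flip @: position h) b_gt0 F0.
have := noD D; rewrite /good_reply sD cD /= => /negbT/forall_inPn[x xD].
by rewrite hD.
Qed.

Lemma breaker_reply_legal : 0 < b -> breaker_strategy b breaker_reply.
Proof.
move=> b_gt0 h _ _ nall.
have [D /and3P[/subsetP sD cD _] ->] := breaker_replyP b_gt0 nall.
split=> [a|a|].
- by rewrite mem_flip => /sD; rewrite inE undirected_flip => /andP[].
- rewrite !mem_flip flipK => faD; apply/negP => aD.
  have /[!inE]/andP[_ ab] := sD _ aD; have /[!inE]/andP[_] := sD _ faD.
  by rewrite backward_flip ?ab ?(backward_irr ab).
by rewrite card_imset //; apply: inv_inj flipK.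
Qed.

Lemma position_rcons h D : position (rcons h D) = D :|: position h.
Proof. by rewrite /position -cats1 big_cat big_seq1 setUC. Qed.

(** The last clause is the potential after Maker's next move.  Stating it for
    the order of the extended history covers the start of the play as well,
    where that order still depends on Maker's move. *)
Definition controlled h :=
  [/\ forall a, a \in position h -> flip a \notin position h,
      weight h (position h) <= n ^ #|V| &
      ~~ odd (size h) -> forall a, undirected (position h) a ->
        weight (rcons h [set a]) (a |: position h) <= n ^ #|V|].

(** [potential_reply] bounds the growth for a backward next move of Maker; a
    forward one is covered by [weight_forward]. *)
Lemma controlled_breaker h : 0 < b -> h != [::] -> ~ all_oriented (position h) ->
  controlled h -> odd (size h) -> controlled (rcons h (breaker_reply h)).
Proof.
move=> b_gt0 h0 nall [anti le_w _] oddh.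
have [D /and3P[/subsetP sD cD /forall_inP hD] ->] := breaker_replyP b_gt0 nall.
set P := position h in nall anti le_w sD hD *.
have fwD a : a \in flip @: D -> ~~ backward h a.
  rewrite mem_flip => /sD; rewrite inE => /andP[_ fab].
  by rewrite -[a]flipK backward_flip ?fab ?(backward_irr fab).
have le_w' : weight h (flip @: D :|: P) <= weight h P.
  apply: potential_le => f x /backward_arcsP xb; rewrite ?mem_flip !inE.
    by case/orP => // /fwD /negP.
  by move=> ->; rewrite orbT.
split; rewrite ?position_rcons -/P.
- move=> a; rewrite !inE !mem_flip flipK.
  have uD x : x \in D -> (x \notin P) && (flip x \notin P).
    by move=> /sD; rewrite inE => /andP[/and3P[_ -> ->]].
  rewrite negb_or => /orP[aD|aP].
    have /andP[-> _] := uD _ aD; rewrite andbT.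
    have := fwD a; rewrite mem_flip => /(_ aD); apply: contra => /sD.
    by rewrite inE => /andP[].
  rewrite anti // andbT; apply/negP => /uD.
  by rewrite aP.
- by rewrite weight_rcons // (leq_trans le_w').
move=> _ a; rewrite setUC undirectedU => /and3P[ua _ aD].
rewrite weight_rcons ?weight_rcons //; last by case: (h).
rewrite mem_flip flipK in aD; case ab: (backward h a); last first.
  by rewrite (leq_trans (weight_forward _ _)) ?ab // setUC (leq_trans le_w').
apply: leq_trans le_w.
have aF : a \in free_backward h P :\: D by rewrite !inE aD ua ab.
apply: leq_trans (hD a aF); apply: potential_le => f x /backward_arcsP xb.
  rewrite !inE => /or3P[-> //|->|/fwD/negP //]; exact: orbT.
rewrite !(inE, mem_flip) flipK => /orP[]->; by rewrite !orbT.
Qed.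

Lemma follows_controlled h : 0 < b -> follows breaker_reply h -> controlled h.
Proof.
move=> b_gt0; elim=> {h} [|h a _ [anti le_w le_wa] evenh ua|h _ ctl oddh nall].
- have pos0 : position [::] = set0 :> {set Defs.arc n}.
    by rewrite /position big_nil.
  rewrite /controlled pos0; split=> [a||_ a ua]; first by rewrite inE.
    exact: weight_set0.
  apply: leq_trans (weight_forward _ _) (weight_set0 _).
  by apply: first_arc_forward; case/and3P: ua.
- split; rewrite ?position_rcons; last by rewrite size_rcons /= evenh.
    have /and3P[aN aP faP] := ua.
    move=> x; rewrite !inE => /predU1P[->|xP].
      by rewrite negb_or faP andbT; apply: contra aN => /eqP/(congr1 fst)/= ->.
    rewrite negb_or anti // andbT; apply: contraNneq faP => <-.
    by rewrite -[X in X \in _]/(flip (flip x)) flipK.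
  exact: le_wa.
by apply: controlled_breaker => //; case: (h) oddh.
Qed.

(** A completed copy would have all its backward arcs claimed by Maker and none
    ruled out, so it alone would weigh more than the [controlled] bound. *)
Lemma breaker_can_avoid_pow : 0 < b -> n ^ #|V| < b.+1 ^ FAS e ->
  breaker_can_avoid n b e.
Proof.
move=> b_gt0 lt_nb; exists breaker_reply; first exact: breaker_reply_legal.
move=> h /(follows_controlled b_gt0)[anti le_w _] _ [f [f_inj fP]].
pose g := finfun f.
have g_inj : injective g by move=> u v; rewrite !ffunE => /f_inj.
have sgP : backward_arcs h g \subset position h.
  by apply/subsetP => _ /imsetP[p /[!inE]/andP[ep _] ->]; rewrite !ffunE fP.
have dg : [disjoint backward_arcs h g & flip @: position h].
  apply/pred0P => x /=; apply/negP => /andP[/(subsetP sgP) xP].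
  by rewrite mem_flip (negbTE (anti _ xP)).
have := leq_trans (expn_card_le_potential b dg sgP) le_w.
rewrite leqNgt (leq_trans lt_nb) // leq_pexp2l //.
exact: leq_card_backward_arcs.
Qed.

End Breaker.

Import Order.TTheory GRing.Theory Num.Theory.

Local Open Scope ring_scope.

Theorem lemma5p1 (R : realType) (V : finType) (e : rel V) (t r : nat)
    (He : oriented_graph e) (Ht : #|V| = t) (Hr : FAS e = r)
    (r_ge1 : (1 <= r)%N) :
  exists c : R, 0 < c /\
    forall n b : nat, (0 < n)%N -> (0 < b)%N ->
      c * n%:R `^ (t%:R / r%:R) < b%:R ->
      breaker_can_avoid n b e.
Proof.
exists 1; split=> // n b _ b_gt0; rewrite mul1r => lt_nb.
apply: breaker_can_avoid_pow => //; rewrite Ht Hr.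
have r_neq0 : r%:R != 0 :> R by rewrite pnatr_eq0 -lt0n.
rewrite -(ltr_nat R) !natrX -[n%:R ^+ t]powR_mulrn // -(divfK r_neq0 t%:R).
rewrite powRrM powR_mulrn ?powR_ge0 //.
by rewrite ltr_pXn2r ?nnegrE ?powR_ge0 // (lt_trans lt_nb) // ltr_nat.
Qed.
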